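(* Let $n$ be an even positive integer, let $\theta_0\in[0,2\pi)$, and let $$\mathcal{A}=\begin{bmatrix} A & B^H\\ B & -C\end{bmatrix}\in\mathbb{C}^{2n\times 2n},$$ where - $A=\mathcal{C}_n(f_A)$ with $f_A$ a trigonometric polynomial such that $f_A(\theta_0)=0$ and $f_A(\theta)>0$ for all $\theta\in[0,2\pi)\setminus\{\theta_0\}$; - $C=\mathcal{C}_n(f_C)$ with $f_C$ a nonnegative trigonometric polynomial; - $B=\mathcal{C}_n(f_B)$ with $f_B$ a trigonometric polynomial such that $|f_B|^2(\theta_0)=0$, $|f_B|^2(\theta)>0$ for all $\theta\in[0,2\pi)\setminus\{\theta_0\}$, and $\limsup_{\theta\to\theta_0}\frac{|f_B|^2(\theta)}{f_A(\theta)}<\infty$. Let $\alpha$ satisfy $0<\alpha<\frac{2\hat a_0(f_A)}{\|f_A\|_\infty}$ and set $$\hat{\mathcal{A}}=\mathcal{L}\mathcal{A}\mathcal{U},\quad \mathcal{L}=\begin{bmatrix} I_n & 0\\ \alpha B D_A^{-1} & -I_n\end{bmatrix},\quad \mathcal{U}=\begin{bmatrix} I_n & -\alpha D_A^{-1}B^H\\ 0 & I_n\end{bmatrix},$$ $$\hat C=C+B\left(2\alpha D_A^{-1}-\alpha^2D_A^{-1}AD_A^{-1}\right)B^H .$$ Then $\hat C=\mathcal{C}_n(f_{\hat C})$ with $$f_{\hat C}(\theta)=f_C(\theta)+\frac{\alpha|f_B|^2(\theta)}{\hat a_0(f_A)}\left(2-\frac{\alpha}{\hat a_0(f_A)}f_A(\theta)\right).$$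 Let $p_A,p_{\hat C}$ be trigonometric polynomials, $P_A=\mathcal{C}_n(p_A)K_n^T$, $P_{\hat C}=\mathcal{C}_n(p_{\hat C})K_n^T$, and $\mathcal{P}=\begin{bmatrix}P_A & 0\\ 0& P_{\hat C}\end{bmatrix}$. Suppose that 1. $|p_A|^2(\theta)+|p_A|^2(\theta+\pi)>0$ and $|p_{\hat C}|^2(\theta)+|p_{\hat C}|^2(\theta+\pi)>0$ for all $\theta\in[0,2\pi]$; 2. $\limsup_{\theta\to\theta_0}\frac{|p_A|^2(\theta+\pi)}{f_A(\theta)}<\infty$ and $\limsup_{\theta\to\theta_0}\frac{|p_{\hat C}|^2(\theta+\pi)}{f_{\hat C}(\theta)}<\infty$; 3. $0<\omega<2\min\left(2\alpha-\frac{\alpha^2}{\hat a_0(f_A)}\|f_A\|_\infty,\ \hat a_0(f_{\hat C})\left\|f_C+\frac{|f_B|^2}{f_A}\right\|_\infty^{-1}\right)$. Then $\rho(\mathrm{TGM}(\hat{\mathcal{A}},\mathcal{P},\omega))<1$.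
   Context: For a trigonometric polynomial $f$, $\hat a_j(f)=\frac1{2\pi}\int_{-\pi}^{\pi}f(\theta)e^{-\mathrm{i}j\theta}\,d\theta$ are its Fourier coefficients, and $\mathcal{C}_n(f)=\mathbb{F}_n\,\mathrm{diag}_{j=1,\dots,n}\big(f(\theta_{j,n})\big)\mathbb{F}_n^H$ is the circulant matrix with symbol $f$, where $\theta_{j,n}=\frac{2\pi(j-1)}{n}$ and $(\mathbb{F}_n)_{i,j}=\frac1{\sqrt n}e^{\mathrm{i}(i-1)\theta_{j,n}}$. Standing assumption: $n$ is larger than the degrees of the trigonometric polynomials $f_A,f_B,f_C,f_{\hat C}$. $D_X$ denotes the diagonal matrix with the same main diagonal as $X$. $\|\cdot\|_\infty$ is the (essential) supremum norm over $[0,2\pi]$; the quotient $|f_B|^2/f_A$ is considered off the zero of $f_A$. The down-sampling matrix $K_n\in\mathbb{R}^{\frac n2\times n}$ has $(K_n)_{i,2i-1}=1$ for $i=1,\dots,n/2$ and all other entries zero. For $X\in\mathbb{C}^{N\times N}$, a full-rank $P\in\mathbb{C}^{N\times k}$ with $k<N$, and $\omega\in\mathbb{R}$, the two-grid iteration matrix with one damped Jacobi post-smoothing step is $$\mathrm{TGM}(X,P,\omega)=(I_N-\omega D_X^{-1}X)\left[I_N-P(P^HXP)^{-1}P^HX\right],$$ and $\rho$ is the spectral radius. Convention for the singular case (which occurs when $\theta_0$ is one of the grid points $\theta_{j,n}$): the inverse $(P^HXP)^{-1}$ is replaced by the Moore–Penrose pseudoinverse, and, since $\mathrm{TGM}(X,P,\omega)$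 then acts as the identity on $\ker X$, $\rho$ denotes the spectral radius of the operator induced on the quotient space $\mathbb{C}^N/\ker X$. When $X$ and $P^HXP$ are nonsingular this is the usual spectral radius. *)

(* Defs.v *)
From HB Require Import structures.
From mathcomp Require Import all_boot all_order all_algebra.
From mathcomp Require Import all_classical all_reals all_analysis.
From mathcomp.real_closed Require Export complex.

Set Implicit Arguments.
Unset Strict Implicit.
Unset Printing Implicit Defensive.

Import Order.TTheory GRing.Theory Num.Theory.
Import numFieldNormedType.Exports.

Local Open Scope classical_set_scope.
Local Open Scope ring_scope.
Local Open Scope complex_scope.
Local Open Scope sesquilinear_scope.

Section Symbols.
Context {R : realType}.

Definition expi (t : R) : R[i] := cos t +i* sin t.

Definition cplx (f : R -> R) : R -> R[i] := fun t => (f t)%:C.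

Definition sqabs (f : R -> R[i]) (t : R) : R := Normc.normc (f t) ^+ 2.

Definition trigpoly_le (d : nat) (f : R -> R[i]) : Prop :=
  exists c : int -> R[i], forall t : R,
    f t = \sum_(k < d.*2.+1)
            c (k%:Z - d%:Z) * expi ((k%:Z - d%:Z)%:~R * t).

Definition trigpoly (f : R -> R[i]) : Prop := exists d, trigpoly_le d f.

Definition trigpoly_lt (n : nat) (f : R -> R[i]) : Prop :=
  exists2 d : nat, (d < n)%N & trigpoly_le d f.

(* Componentwise Lebesgue integral of a complex-valued function. *)
Definition cintegral (D : set R) (f : R -> R[i]) : R[i] :=
  (\int[@lebesgue_measure R]_(t in D) complex.Re (f t)) +i*
  (\int[@lebesgue_measure R]_(t in D) complex.Im (f t)).

Definition fourier_coef (f : R -> R[i]) (j : int) : R[i] :=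
  ((2 * pi)^-1)%:C *
    cintegral `[- pi, pi] (fun t => f t * expi (- (j%:~R * t))).

(* The coefficient of index 0 of a real-valued symbol is real, so taking the
   real part only changes its type. *)
Definition fourier0 (f : R -> R) : R := complex.Re (fourier_coef (cplx f) 0).

(* The norm of L^oo([0, 2 pi]). As it is an essential supremum, the value of
   f at a single point (such as x / 0 = 0) is irrelevant. *)
Definition supnorm (f : R -> R) : R :=
  fine (Lnorm (mrestr (@lebesgue_measure R)
                 (measurable_itv (`[0, 2 * pi] : interval R)))
              +oo%E (EFin \o f)).

(* Indices are shifted: j : 'I_n stands for the index j + 1 of 1, ..., n. *)
Definition grid (n : nat) (j : 'I_n) : R := 2 * pi * j%:R / n%:R.

Definition fourier_mx (n : nat) : 'M[R[i]]_n :=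
  \matrix_(i < n, j < n) (((Num.sqrt n%:R)^-1)%:C * expi (i%:R * grid j)).

Definition circulant (n : nat) (f : R -> R[i]) : 'M[R[i]]_n :=
  fourier_mx n *m diag_mx (\row_(j < n) f (grid j)) *m (fourier_mx n)^t*.

Definition downsample (n : nat) : 'M[R[i]]_(n./2, n) :=
  \matrix_(i < n./2, j < n) (j == i.*2 :> nat)%:R.

Definition prolongation (n : nat) (p : R -> R[i]) : 'M[R[i]]_(n, n./2) :=
  circulant n p *m (downsample n)^T.

Definition schur_symbol (alpha : R) (fA : R -> R) (fB : R -> R[i])
    (fC : R -> R) (t : R) : R :=
  fC t + alpha * sqabs fB t / fourier0 fA
         * (2 - alpha / fourier0 fA * fA t).

End Symbols.

Section TwoGrid.
Context {R : realType}.
Local Notation C := R[i].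

Definition diag_part (N : nat) (X : 'M[C]_N) : 'M[C]_N :=
  diag_mx (\row_i X i i).

Definition penrose (m n : nat) (A : 'M[C]_(m, n)) (Y : 'M[C]_(n, m)) : Prop :=
  [/\ A *m Y *m A = A, Y *m A *m Y = Y,
      (A *m Y)^t* = A *m Y & (Y *m A)^t* = Y *m A].

(* Not to be confused with pinvmx, which is only some generalized inverse;
   see moore_penroseP and penrose_unique. *)
Definition moore_penrose (m n : nat) (A : 'M[C]_(m, n)) : 'M[C]_(n, m) :=
  xget 0 [set Y | penrose A Y].

Definition TGM (N k : nat) (X : 'M[C]_N) (P : 'M[C]_(N, k)) (omega : R) :
    'M[C]_N :=
  (1%:M - omega%:C *: (invmx (diag_part X) *m X)) *m
  (1%:M - P *m moore_penrose (P^t* *m X *m P) *m P^t* *m X).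

(* l is an eigenvalue of the operator induced by T on C^N / ker X (for T
   leaving ker X invariant): the class of some v outside ker X is mapped to l
   times itself. *)
Definition quotient_eigenvalue (N : nat) (X T : 'M[C]_N) (l : C) : Prop :=
  exists v : 'cV[C]_N, X *m v <> 0 /\ X *m (T *m v - l *: v) = 0.

(* The set is finite; sup set0 = 0 covers the zero quotient. *)
Definition quotient_spectral_radius (N : nat) (X T : 'M[C]_N) : R :=
  sup [set Normc.normc l | l in quotient_eigenvalue X T].

Definition rho_TGM (N k : nat) (X : 'M[C]_N) (P : 'M[C]_(N, k)) (omega : R) :
    R :=
  quotient_spectral_radius X (TGM X P omega).

Lemma TGM_ker (N k : nat) (X : 'M[C]_N) (P : 'M[C]_(N, k)) (omega : R)
    (v : 'cV[C]_N) : X *m v = 0 -> TGM X P omega *m v = v.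
Proof.
move=> Xv0; rewrite /TGM.
set Q := P *m _ *m _; set S := invmx _.
rewrite -[LHS]mulmxA.
have -> : (1%:M - Q *m X) *m v = v.
  by rewrite mulmxBl mul1mx -mulmxA Xv0 mulmx0 subr0.
by rewrite mulmxBl mul1mx -scalemxAl -mulmxA Xv0 mulmx0 scaler0 subr0.
Qed.

Lemma quotient_eigenvalue_unit (N : nat) (X T : 'M[C]_N) (l : C) :
  X \in unitmx ->
  quotient_eigenvalue X T l <-> exists2 v : 'cV[C]_N, v <> 0 & T *m v = l *: v.
Proof.
move=> uX; have Xi (v : 'cV[C]_N) : X *m v = 0 -> v = 0.
  by move=> Xv0; rewrite -[v](mulKmx uX) Xv0 mulmx0.
split=> [[v [Xv0 Tv]]|[v v0 Tv]]; exists v.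
- by move=> v0; apply: Xv0; rewrite v0 mulmx0.
- by apply/eqP; rewrite -subr_eq0; apply/eqP/Xi.
- by split; [move/Xi | rewrite Tv subrr mulmx0].
Qed.

Lemma adjmxM (m n p : nat) (A : 'M[C]_(m, n)) (B : 'M[C]_(n, p)) :
  (A *m B)^t* = B^t* *m A^t*.
Proof. by rewrite trmx_mul map_mxM. Qed.

Lemma adjmx1 (n : nat) : (1%:M : 'M[C]_n)^t* = 1%:M.
Proof. by rewrite trmx1 map_mx1. Qed.

Lemma adjmx_inv (n : nat) (A : 'M[C]_n) : (invmx A)^t* = invmx (A^t* ).
Proof. by rewrite trmx_inv map_invmx. Qed.

Lemma rowmx_adj_eq0 (n : nat) (u : 'rV[C]_n) : u *m u^t* = 0 -> u = 0.
Proof.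
move=> /matrixP/(_ 0 0); rewrite !mxE => u0; apply/rowP => j; rewrite mxE.
have /psumr_eq0P/(_ u0 j isT) : forall i : 'I_n, true -> 0 <= u 0 i * (u^t* ) i 0.
  by move=> i _; rewrite !mxE -normCK exprn_ge0.
by rewrite !mxE -normCK => /eqP; rewrite expf_eq0 /= normr_eq0 => /eqP.
Qed.

Lemma gram_unit (m n : nat) (A : 'M[C]_(m, n)) :
  row_free A -> A *m A^t* \in unitmx.
Proof.
move=> fA; rewrite -row_free_unit -kermx_eq0; apply/rowV0P => v /sub_kermxP vA0.
have /rowmx_adj_eq0 : (v *m A) *m (v *m A)^t* = 0.
  by rewrite adjmxM mulmxA -[v *m A *m _]mulmxA vA0 mul0mx.
by move/eqP; rewrite mulmx_free_eq0// => /eqP.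
Qed.

Lemma penrose_full_rank (m r n : nat) (K : 'M[C]_(m, r)) (F : 'M[C]_(r, n)) :
  row_full K -> row_free F ->
  penrose (K *m F)
    (F^t* *m invmx (F *m F^t* ) *m invmx (K^t* *m K) *m K^t* ).
Proof.
move=> fullK freeF; have uF := gram_unit freeF.
have uK : K^t* *m K \in unitmx.
  have fK : row_free (K^t* ) by rewrite /row_free mxrank_map mxrank_tr.
  by have := gram_unit fK; rewrite trmxCK.
set Y := _ *m K^t*.
have AY : K *m F *m Y = K *m invmx (K^t* *m K) *m K^t*.
  have -> : K *m F *m Y = K *m ((F *m F^t* ) *m invmx (F *m F^t* ))
                            *m invmx (K^t* *m K) *m K^t* by rewrite /Y !mulmxA.
  by rewrite mulmxV// mulmx1.
have YA : Y *m (K *m F) = F^t* *m invmx (F *m F^t* ) *m F.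
  have -> : Y *m (K *m F) = F^t* *m invmx (F *m F^t* )
              *m (invmx (K^t* *m K) *m (K^t* *m K)) *m F by rewrite /Y !mulmxA.
  by rewrite mulVmx// mulmx1.
split.
- rewrite AY.
  have -> : K *m invmx (K^t* *m K) *m K^t* *m (K *m F) =
            K *m (invmx (K^t* *m K) *m (K^t* *m K)) *m F by rewrite !mulmxA.
  by rewrite mulVmx// mulmx1.
- rewrite YA.
  have -> : F^t* *m invmx (F *m F^t* ) *m F *m Y =
            F^t* *m (invmx (F *m F^t* ) *m (F *m F^t* ))
              *m invmx (F *m F^t* ) *m invmx (K^t* *m K) *m K^t*.
    by rewrite /Y !mulmxA.
  by rewrite mulVmx// mulmx1.
- by rewrite AY !adjmxM adjmx_inv adjmxM trmxCK mulmxA.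
- by rewrite YA !adjmxM adjmx_inv adjmxM trmxCK mulmxA.
Qed.

Lemma moore_penroseP (m n : nat) (A : 'M[C]_(m, n)) :
  penrose A (moore_penrose A).
Proof.
rewrite /moore_penrose; case: xgetP => [//|/= noY]; exfalso.
have := penrose_full_rank (col_base_full A) (row_base_free A).
by rewrite mulmx_base; exact: noY.
Qed.

Lemma penrose_unique (m n : nat) (A : 'M[C]_(m, n)) (Y Z : 'M[C]_(n, m)) :
  penrose A Y -> penrose A Z -> Y = Z.
Proof.
move=> [AYA YAY AYh YAh] [AZA ZAZ AZh ZAh].
have AYZ : A *m Y = A *m Z.
  rewrite -[LHS]AYh -{1}AZA -[A *m Z *m A *m Y]mulmxA adjmxM AYh AZh.
  by rewrite mulmxA AYA.
have YZA : Y *m A = Z *m A.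
  rewrite -[LHS]YAh -{1}AZA -[A *m Z *m A]mulmxA mulmxA adjmxM YAh ZAh.
  by rewrite -mulmxA [A *m (Y *m A)]mulmxA AYA.
by rewrite -YAY -mulmxA AYZ mulmxA YZA ZAZ.
Qed.

Lemma moore_penrose_inv (n : nat) (A : 'M[C]_n) :
  A \in unitmx -> moore_penrose A = invmx A.
Proof.
move=> uA; apply: (penrose_unique (moore_penroseP A)); split.
- by rewrite mulmxV// mul1mx.
- by rewrite mulVmx// mul1mx.
- by rewrite mulmxV// adjmx1.
- by rewrite mulVmx// adjmx1.
Qed.

End TwoGrid.

Section SaddlePoint.
Context {R : realType} {n : nat}.
Variables (alpha : R) (A B C : 'M[R[i]]_n).

Definition saddle_mx : 'M[R[i]]_(n + n) := block_mx A (B^t* ) B (- C).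

Definition saddle_L : 'M[R[i]]_(n + n) :=
  block_mx 1%:M 0 (alpha%:C *: (B *m invmx (diag_part A))) (- 1%:M).

Definition saddle_U : 'M[R[i]]_(n + n) :=
  block_mx 1%:M (- (alpha%:C *: (invmx (diag_part A) *m B^t* ))) 0 1%:M.

Definition saddle_hat : 'M[R[i]]_(n + n) := saddle_L *m saddle_mx *m saddle_U.

Definition schur_hat : 'M[R[i]]_n :=
  C + B *m ((2 * alpha)%:C *: invmx (diag_part A)
            - (alpha ^+ 2)%:C *:
                (invmx (diag_part A) *m A *m invmx (diag_part A))) *m B^t*.

End SaddlePoint.

(* Main.v *)
Require Import Defs.
From HB Require Import structures.
From mathcomp Require Import all_boot all_order all_algebra.
From mathcomp Require Import all_classical all_reals all_analysis.
From mathcomp Require Import ess_sup_inf zify ring lra.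
Import Order.TTheory GRing.Theory Num.Theory.
Import numFieldNormedType.Exports.
Local Open Scope classical_set_scope.
Local Open Scope ring_scope.

(** All blocks of X = saddle_hat are circulant, X = [[A, G^H], [- G, Chat]] with
    G = B (I - alpha A / a0), because the diagonal of a circulant matrix of
    degree less than n is the constant a0 = fourier0 of its symbol. So X is
    unitarily a direct sum of 2x2 matrices [[a, conj g], [- g, c]], one for each
    frequency.

    If l is an eigenvalue of the two-grid operator on the quotient by ker X, w
    the coarse-grid corrected eigenvector and r = X w, then P^H r = 0 yields
    (1 - l) r^H w = omega r^H D^-1 r. Hence |l| < 1 as soon as
    omega r^H D^-1 r < 2 Re (w^H X w), where D is the diagonal part of X. In a
    single frequency of determinant d = a c + |g|^2 = a fC + |fB|^2, one has
    d (a |w1|^2 + c |w2|^2) = c |r1|^2 + a |r2|^2, and the inequality reduces to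
    omega d < 2 a0 c and omega d < 2 c0 a, which are the two bounds on omega. *)

(** * The Hermitian inner product on column vectors *)

Section HermitianProduct.
Context {R : realType}.
Local Notation C := R[i].
Local Open Scope complex_scope.
Local Open Scope sesquilinear_scope.
Implicit Types n m : nat.

Definition cdot n (x y : 'cV[C]_n) : C := (x^t* *m y) 0 0.

Lemma cdotE n (x y : 'cV[C]_n) : cdot n x y = \sum_i (x i 0)^*%R * y i 0.
Proof. by rewrite /cdot mxE; apply: eq_bigr => i _; rewrite !mxE. Qed.

Lemma cdot_conj n (x y : 'cV[C]_n) : (cdot n x y)^*%R = cdot n y x.
Proof.
rewrite !cdotE rmorph_sum; apply: eq_bigr => i _ /=.
by rewrite rmorphM /= conjCK mulrC.
Qed.

Lemma cdot_mull n m (M : 'M[C]_(m, n)) (x : 'cV[C]_n) (y : 'cV[C]_m) :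
  cdot m (M *m x) y = cdot n x (M^t* *m y).
Proof. by rewrite /cdot adjmxM mulmxA. Qed.

Lemma cdot_mulr n m (M : 'M[C]_(m, n)) (x : 'cV[C]_n) (y : 'cV[C]_m) :
  cdot m y (M *m x) = cdot n (M^t* *m y) x.
Proof. by rewrite cdot_mull trmxCK. Qed.

Lemma cdotDr n (x y z : 'cV[C]_n) : cdot n x (y + z) = cdot n x y + cdot n x z.
Proof. by rewrite /cdot mulmxDr mxE. Qed.

Lemma cdotNr n (x y : 'cV[C]_n) : cdot n x (- y) = - cdot n x y.
Proof. by rewrite /cdot mulmxN mxE. Qed.

Lemma cdotZr n (a : C) (x y : 'cV[C]_n) : cdot n x (a *: y) = a * cdot n x y.
Proof. by rewrite /cdot -scalemxAr mxE. Qed.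

Lemma cdot0r n (x : 'cV[C]_n) : cdot n x 0 = 0.
Proof. by rewrite /cdot mulmx0 mxE. Qed.

Lemma cdot0l n (x : 'cV[C]_n) : cdot n 0 x = 0.
Proof. by rewrite -cdot_conj cdot0r conjC0. Qed.

Lemma cdotxx n (x : 'cV[C]_n) : cdot n x x = \sum_i `|x i 0| ^+ 2.
Proof. by rewrite cdotE; apply: eq_bigr => i _; rewrite normCK mulrC. Qed.

Lemma cdotxx_eq0 n (x : 'cV[C]_n) : cdot n x x = 0 -> x = 0.
Proof.
rewrite cdotxx => x0; apply/colP => i; rewrite mxE.
have /psumr_eq0P/(_ x0 i isT)/eqP :
  forall j : 'I_n, true -> 0 <= `|x j 0| ^+ 2 by move=> j _; rewrite exprn_ge0.
by rewrite expf_eq0 /= normr_eq0 => /eqP.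
Qed.

Lemma cdot_col_mx n m (x1 y1 : 'cV[C]_n) (x2 y2 : 'cV[C]_m) :
  cdot (n + m) (col_mx x1 x2) (col_mx y1 y2) = cdot n x1 y1 + cdot m x2 y2.
Proof.
rewrite !cdotE big_split_ord /=.
by congr (_ + _); apply: eq_bigr => i _; rewrite ?col_mxEu ?col_mxEd.
Qed.

(** Bridges the real-valued modulus of the spectral radius and the [R[i]]-valued norm in which the
    estimates are computed. *)
Lemma normc_lt1 (l : C) : (Normc.normc l < 1) = (`|l| < 1).
Proof. by rewrite -ltcR. Qed.

End HermitianProduct.

Arguments cdot {R n} x y.

(** * Energy estimate for the two-grid eigenvalues *)

Section TwoGridConvergence.
Context {R : realType}.
Local Notation C := R[i].
Local Open Scope complex_scope.
Local Open Scope sesquilinear_scope.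
Variables (N k : nat) (X : 'M[C]_N) (P : 'M[C]_(N, k)) (omega : R).
Let E := invmx (diag_part X).
Hypothesis omega_gt0 : 0 < omega.
Hypothesis E_gt0 : forall r : 'cV[C]_N, r != 0 -> 0 < cdot r (E *m r).
Hypothesis smoothing : forall w : 'cV[C]_N, X *m w != 0 ->
  omega%:C * cdot (X *m w) (E *m (X *m w)) < cdot w (X *m w) + cdot (X *m w) w.
Hypothesis ker_adj : forall w : 'cV[C]_N, X *m w = 0 -> X^t* *m w = 0.

Let M := P^t* *m X *m P.
Let Y := moore_penrose M.

(* The Hermitian part of X vanishes only on ker X, so the kernels of M and of
   its adjoint both map into ker X under P. *)
Lemma coarse_projection_orthogonal :
  P^t* *m X *m (1%:M - P *m Y *m P^t* *m X) = 0.
Proof.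
have [MYM YMY MYh YMh] := moore_penroseP M.
rewrite -/Y in MYM YMY MYh YMh.
(* [M *m Y] is the orthogonal projector onto the range of [M], so [Q] is Hermitian and annihilates
   [M]; the goal becomes [Q *m (P^t* *m X) = 0], proved through its adjoint. *)
set Q := 1%:M - M *m Y.
have -> : P^t* *m X *m (1%:M - P *m Y *m P^t* *m X) = Q *m (P^t* *m X).
  by rewrite mulmxBr mulmx1 /Q mulmxBl mul1mx /M !mulmxA.
have Qh : Q^t* = Q by rewrite /Q linearB rmorphB /= MYh adjmx1.
have QM : Q *m M = 0 by rewrite /Q mulmxBl mul1mx MYM subrr.
have XPQ (y : 'cV_k) : X^t* *m (P *m (Q *m y)) = 0.
  (* The energy of [w] is a quadratic form in [Q *m M *m Q], hence zero, while [smoothing] would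
     make it positive if [X *m w] were nonzero. *)
  set w := P *m (Q *m y); apply/ker_adj/eqP; apply/negPn/negP => Xw0.
  have wXw : cdot w (X *m w) = 0.
    rewrite /w cdot_mull mulmxA -/M cdot_mull Qh !mulmxA.
    by have -> : Q *m P^t* *m X *m P = Q *m M; [rewrite /M !mulmxA |
       rewrite QM !mul0mx cdot0r].
  have Xww : cdot (X *m w) w = 0 by rewrite -cdot_conj wXw conjC0.
  have := smoothing _ Xw0; rewrite wXw Xww addr0.
  apply/negP; rewrite lt_gtF // mulr_gt0 ?E_gt0 //.
  by rewrite ltcR.
apply/matrixP => i j; rewrite mxE.
have : cdot (Q *m delta_mx i 0) ((P^t* *m X) *m delta_mx j (0 : 'I_1)) = 0.
  by rewrite cdot_mulr adjmxM trmxCK -mulmxA XPQ cdot0l.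
rewrite cdot_mull Qh mulmxA cdotE (bigD1 i) //= big1 => [|i' i'i].
  by rewrite -colE !mxE !eqxx conjC1 mul1r addr0.
by rewrite !mxE (negPf i'i) conjC0 mul0r.
Qed.

(** Testing the eigenvalue equation against [r = X *m w] removes the coarse component [P *m y] and
    leaves [s - e = l * s], with [s = cdot r w] and [e] the smoothing term. Since [0 < e < 2 Re s],
    subtracting [e] moves [s] closer to the origin. *)
Lemma TGM_quotient_eigenvalue_lt1 (l : C) :
  quotient_eigenvalue X (TGM X P omega) l -> Normc.normc l < 1.
Proof.
case=> v [Xv0]; set T := TGM X P omega.
set w := (1%:M - P *m Y *m P^t* *m X) *m v; set y := Y *m P^t* *m X *m v.
have Tv : T *m v = w - omega%:C *: (E *m (X *m w)).
  rewrite /T /TGM -/M -/Y -/E -[LHS]mulmxA -/w.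
  by rewrite mulmxBl mul1mx -scalemxAl -mulmxA.
have vE : v = w + P *m y.
  by rewrite /w /y mulmxBl mul1mx !mulmxA subrK.
have Pr : P^t* *m (X *m w) = 0.
  by rewrite /w !mulmxA coarse_projection_orthogonal mul0mx.
move=> XTv; rewrite normc_lt1.
(* If the coarse correction already lands in the kernel, then [T *m v = w] is zero in the quotient,
   so [l = 0]. *)
have [Xw0|Xw0] := eqVneq (X *m w) 0.
  move: XTv; rewrite Tv Xw0 mulmx0 scaler0 subr0 mulmxBr Xw0 sub0r -scalemxAr.
  move/eqP; rewrite oppr_eq0 scaler_eq0 => /orP[/eqP->|/eqP//].
  by rewrite normr0 ltr01.
set r := X *m w in Xw0 Pr Tv.
have : cdot r (T *m v - l *: v) = 0.
  by rewrite /r cdot_mull (ker_adj _ XTv) cdot0r.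
rewrite Tv vE scalerDr opprD addrA !cdotDr !cdotNr !cdotZr.
rewrite [cdot r (P *m y)]cdot_mulr Pr cdot0l mulr0 subr0.
have := smoothing _ Xw0; rewrite -/r.
have e0 : 0 < omega%:C * cdot r (E *m r).
  by rewrite mulr_gt0 ?E_gt0 // ltcR.
set e := _ * _ in e0 *; rewrite -[cdot w r]cdot_conj; set s := cdot r w => es.
move=> /eqP; rewrite subr_eq0 => /eqP ls.
have s0 : s != 0.
  by apply/eqP => s0; move: (lt_trans e0 es); rewrite s0 conjC0 addr0 ltxx.
have ns0 : 0 < `|s| ^+ 2 by rewrite exprn_gt0 // normr_gt0.
rewrite -(@ltr_pXn2r _ 2) ?nnegrE // expr1n -(ltr_pM2r ns0) mul1r.
rewrite -exprMn -normrM.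
rewrite -ls !normCK rmorphB /=.
have -> : e^*%R = e by apply/CrealP/gtr0_real.
rewrite -subr_gt0.
(* As [e] is real, this is the difference of [|s|^2] and [|s - e|^2], a product of two positive
   factors. *)
have -> : s * s^*%R - (s - e) * (s^*%R - e) = e * ((s^*%R + s) - e) by ring.
by rewrite mulr_gt0 // subr_gt0.
Qed.

End TwoGridConvergence.

(** * From bounds on eigenvalues to the spectral radius *)

Section SpectralRadius.
Context {R : realType}.
Local Notation C := R[i].

Lemma quotient_spectral_radius_lt1 (N : nat) (X T : 'M[C]_N) :
  (forall v : 'cV[C]_N, X *m v = 0 -> X *m (T *m v) = 0) ->
  (forall l, quotient_eigenvalue X T l -> Normc.normc l < 1) ->
  quotient_spectral_radius X T < 1.
Proof.
move=> kerT lt1.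
(* The operator induced on the quotient is similar to one on the range of X,
   so its eigenvalues are roots of a characteristic polynomial. *)
have [Y XYX] : exists Y : 'M[C]_N,
    forall v : 'cV[C]_N, X *m (Y *m (X *m v)) = X *m v.
  by exists (pinvmx X) => v; rewrite mulmxA mulmxA mulmxKpV.
pose S := X *m T *m Y.
have [s /= Ss] := closed_field_poly_normal (char_poly S^T).
have sP l : quotient_eigenvalue X T l -> l \in s.
  case=> v [/eqP Xv0 XTv]; have: root (char_poly S^T) l.
    (* [eigenvalue] is about row vectors, hence the transposes. [S] sends [X *m v] to
       [X *m (T *m v)] because [v] and [Y *m (X *m v)] differ by an element of the kernel, which [T]
       preserves. *)
    rewrite -eigenvalue_root_char; apply/eigenvalueP; exists (X *m v)^T.
      rewrite -trmx_mul -linearZ /=; congr trmx.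
      have /kerT : X *m (v - Y *m (X *m v)) = 0.
        by rewrite mulmxBr XYX subrr.
      rewrite !mulmxBr => /eqP; rewrite subr_eq0 => /eqP XTE.
      rewrite /S -!mulmxA -XTE; apply/eqP.
      by rewrite scalemxAr -subr_eq0 -mulmxBr XTv.
    by rewrite trmx_eq0.
  rewrite Ss rootZ ?root_prod_XsubC //.
  by rewrite lead_coef_eq0 -size_poly_eq0 size_char_poly.
(* A supremum of numbers below 1 could equal 1; a maximum over a finite list cannot. Every quotient
   eigenvalue passes the filter by [lt1]. *)
pose q := \big[Num.max/0]_(z <- s | Normc.normc z < 1) Normc.normc z.
have q1 : q < 1.
  rewrite /q; elim/big_rec: _ => [|z x z1 x1]; first exact: ltr01.
  by rewrite gt_max z1 x1.
apply: le_lt_trans q1; rewrite /quotient_spectral_radius.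
set V := (X in sup X).
have [->|V0] := eqVneq V set0.
  by rewrite sup0 /q; elim/big_rec: _ => // z x _ x0; rewrite le_max x0 orbT.
apply: ge_sup; first by apply/set0P.
move=> _ [l ql <-]; rewrite /q.
by apply: (le_bigmax_seq _ l); [exact: sP | exact: lt1].
Qed.

End SpectralRadius.

(** * Roots of unity and unitarity of the Fourier matrix *)

Section TrigonometricSums.
Context {R : realType}.
Local Notation C := R[i].
Local Open Scope complex_scope.
Local Open Scope sesquilinear_scope.

Lemma conjC_realC (x : R) : (x%:C)^*%R = x%:C.
Proof. exact: conjc_real. Qed.

Lemma expi0 : expi (0 : R) = 1.
Proof. by rewrite /expi cos0 sin0. Qed.

Lemma expiD (s t : R) : expi (s + t) = expi s * expi t.
Proof.
apply/eqP; rewrite eq_complex /= cosD sinD eqxx /=.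
by rewrite addrC.
Qed.

Lemma expi_natl (k : nat) (t : R) : expi (k%:R * t) = expi t ^+ k.
Proof.
elim: k => [|k IH]; first by rewrite mul0r expi0.
by rewrite -[k.+1]addn1 natrD mulrDl mul1r expiD IH exprD.
Qed.

Lemma expi_conj (t : R) : (expi t)^*%R = expi (- t).
Proof. by rewrite /expi cosN sinN. Qed.

Lemma expi_2pi : expi (2 * pi : R) = 1.
Proof. by rewrite mulr_natl /expi cos2pi sin2pi. Qed.

Lemma expi_neq1 (t : R) : 0 < t < 2 * pi -> expi t != 1.
Proof.
move=> /andP[t0 t2]; rewrite eq_complex /= negb_and; apply/orP; left.
have -> : t = (t / 2) *+ 2 by rewrite -mulr_natr divfK.
rewrite cos_mulr2n cos2sin2.
have s0 : 0 < sin (t / 2) by apply: sin_gt0_pi; apply/andP; split; lra.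
have := exprn_gt0 2 s0; set x := _ ^+ 2 => x0.
by apply/eqP => E; lra.
Qed.

(** A geometric sum whose ratio [z] is an [n]-th root of unity; the bounds on [k] exclude
    [z = 1]. *)
Lemma sum_expi_grid_nat (n k : nat) : (0 < k < n)%N ->
  \sum_(j < n) expi (k%:R * grid j : R) = 0.
Proof.
move=> /andP[k0 kn]; have n0 : (n%:R : R) != 0 by rewrite pnatr_eq0; lia.
pose z : C := expi (k%:R * (2 * pi) / n%:R).
have zE (j : 'I_n) : expi (k%:R * grid j : R) = z ^+ j.
  by rewrite -expi_natl /grid; congr expi; field.
have z1 : z - 1 != 0.
  rewrite subr_eq0; apply: expi_neq1; apply/andP; split.
    by rewrite divr_gt0 ?mulr_gt0 ?pi_gt0 ?ltr0n //; lia.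
  rewrite ltr_pdivrMr ?ltr0n; last by lia.
  by rewrite mulrC ltr_pM2l ?mulr_gt0 ?pi_gt0 // ltr_nat.
under eq_bigr do rewrite zE.
have : (z - 1) * \sum_(j < n) z ^+ j = 0.
  rewrite -subrX1 /z -expi_natl.
  have -> : n%:R * (k%:R * (2 * pi) / n%:R) = k%:R * (2 * pi) :> R by field.
  by rewrite expi_natl expi_2pi expr1n subrr.
by move/eqP; rewrite mulf_eq0 (negPf z1) => /eqP.
Qed.

Lemma sum_expi_grid (n : nat) (k : int) : (`|k| < n)%N ->
  \sum_(j < n) expi (k%:~R * grid j : R) = (k == 0)%:R * n%:R.
Proof.
move=> kn; have [->|k0] := eqVneq k 0.
  under eq_bigr do rewrite mul0r expi0.
  by rewrite sumr_const card_ord mul1r.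
have /sum_expi_grid_nat S : (0 < `|k| < n)%N by rewrite absz_gt0 k0.
case: k k0 kn S => k k0 kn S; first by rewrite S mul0r.
(* Negative frequencies follow by conjugating the sum for the opposite one. *)
move/(congr1 Num.conj): S; rewrite mul0r conjC0 rmorph_sum; apply: etrans.
apply: eq_bigr => j _.
by rewrite /= expi_conj NegzE mulrNz mulNr.
Qed.

Lemma fourier_mx_adjM (n : nat) : (0 < n)%N ->
  (fourier_mx n)^t* *m fourier_mx n = 1%:M :> 'M[C]_n.
Proof.
move=> n0; have n0R : (n%:R : R) != 0 by rewrite pnatr_eq0; lia.
apply/matrixP => i j; rewrite !mxE.
have sq : ((Num.sqrt n%:R)^-1)%:C * ((Num.sqrt n%:R)^-1)%:C = (n%:R^-1)%:C :> C.
  by rewrite -rmorphM /= -invfM -expr2 sqr_sqrtr.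
transitivity (\sum_(k < n) (n%:R^-1)%:C *
    expi ((j%:Z - i%:Z)%:~R * grid k) : C).
  apply: eq_bigr => k _; rewrite !mxE rmorphM /= expi_conj.
  rewrite conjC_realC mulrACA sq -expiD; congr (_ * expi _).
  by rewrite /grid intrB -!pmulrn; field.
rewrite -mulr_sumr sum_expi_grid; last first.
  by have := ltn_ord i; have := ltn_ord j; lia.
have nV : (n%:R^-1)%:C * n%:R = 1 :> C.
  by rewrite fmorphV rmorph_nat mulVf // pnatr_eq0 -lt0n.
rewrite subr_eq0 mulrCA nV mulr1.
by rewrite eq_sym.
Qed.

Lemma fourier_mxM_adj (n : nat) : (0 < n)%N ->
  fourier_mx n *m (fourier_mx n)^t* = 1%:M :> 'M[C]_n.
Proof. by move=> n0; apply/mulmx1C/fourier_mx_adjM. Qed.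

End TrigonometricSums.

(** * Algebra of circulant matrices *)

Section CirculantAlgebra.
Context {R : realType} {n : nat}.
Local Notation C := R[i].
Local Open Scope complex_scope.
Local Open Scope sesquilinear_scope.
Implicit Types f g : R -> C.

Lemma eq_circulant f g : (forall j : 'I_n, f (grid j) = g (grid j)) ->
  circulant n f = circulant n g.
Proof.
move=> fg; rewrite /circulant; congr (_ *m diag_mx _ *m _).
by apply/rowP => j; rewrite !mxE fg.
Qed.

Lemma circulantD f g :
  circulant n (fun t => f t + g t) = circulant n f + circulant n g.
Proof.
rewrite /circulant -mulmxDl -mulmxDr -linearD /=; congr (_ *m diag_mx _ *m _).
by apply/rowP => j; rewrite !mxE.
Qed.

Lemma circulantZ (a : C) f :
  circulant n (fun t => a * f t) = a *: circulant n f.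
Proof.
rewrite /circulant scalemxAl scalemxAr -linearZ /=.
by congr (_ *m diag_mx _ *m _); apply/rowP => j; rewrite !mxE.
Qed.

Lemma circulant_adj f : (circulant n f)^t* = circulant n (fun t => (f t)^*%R).
Proof.
rewrite /circulant !adjmxM trmxCK mulmxA tr_diag_mx map_diag_mx.
by congr (_ *m diag_mx _ *m _); apply/rowP => j; rewrite !mxE.
Qed.

Hypothesis n_gt0 : (0 < n)%N.

Lemma circulantM f g :
  circulant n f *m circulant n g = circulant n (fun t => f t * g t).
Proof.
rewrite /circulant !mulmxA -[_ *m _^t* *m _]mulmxA fourier_mx_adjM // mulmx1.
rewrite -[_ *m diag_mx _ *m diag_mx _]mulmxA mulmx_diag.
by congr (_ *m diag_mx _ *m _); apply/rowP => j; rewrite !mxE.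
Qed.

Lemma circulant1 : circulant n (fun=> 1) = 1%:M :> 'M[C]_n.
Proof.
rewrite /circulant -(fourier_mxM_adj n n_gt0); congr (_ *m _).
rewrite -[RHS]mulmx1; congr (_ *m _).
rewrite -diag_const_mx; congr diag_mx.
by apply/rowP => j; rewrite !mxE.
Qed.

Lemma circulant_cst (a : C) : circulant n (fun=> a) = a%:M.
Proof.
rewrite -scalemx1 -circulant1 -circulantZ.
by apply: eq_circulant => j; rewrite mulr1.
Qed.

Lemma circulant_diag f (i : 'I_n) :
  circulant n f i i = n%:R^-1 * \sum_(j < n) f (grid j).
Proof.
have n0 : 0 < (n%:R : R) by rewrite ltr0n.
rewrite /circulant mul_mx_diag mxE mulr_sumr; apply: eq_bigr => j _.
rewrite !mxE rmorphM /= mulrAC mulrACA expi_conj -expiD subrr expi0 mulr1.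
rewrite conjC_realC -rmorphM /= -invfM -expr2 sqr_sqrtr ?ltW //.
by rewrite fmorphV rmorph_nat.
Qed.

(** A diagonal entry is the mean of the symbol over the grid. With degree below [n] no nonzero
    frequency aliases to 0, so only the constant term survives. *)
Lemma circulant_diag_trig d (c : int -> C) f (i : 'I_n) : (d < n)%N ->
  (forall t : R, f t = \sum_(k < d.*2.+1)
     c (k%:Z - d%:Z) * expi ((k%:Z - d%:Z)%:~R * t)) ->
  circulant n f i i = c 0.
Proof.
move=> dn fE; have n0 : (n%:R : C) != 0 by rewrite pnatr_eq0 -lt0n.
rewrite circulant_diag; under eq_bigr do rewrite fE.
rewrite exchange_big /=.
under eq_bigr => k _.
  rewrite -mulr_sumr sum_expi_grid; last by have := ltn_ord k; lia.
  over.
have dd : (d < d.*2.+1)%N by lia.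
rewrite (bigD1 (Ordinal dd)) //= subrr eqxx mul1r big1 ?addr0.
  by rewrite mulrCA mulVf // mulr1.
move=> k kd; have /negPf -> : k%:Z - d%:Z != 0.
  rewrite subr_eq0; apply: contra kd => /eqP[kd].
  by apply/eqP/val_inj.
by rewrite mul0r mulr0.
Qed.

End CirculantAlgebra.

(** * Continuity and mean values of trigonometric polynomials *)

Section TrigonometricPolynomials.
Context {R : realType}.
Local Notation C := R[i].
Local Open Scope complex_scope.

(** The common shape of the real and imaginary parts of [c * expi (m * t)], which reduces continuity
    and integration to real analysis. *)
Definition harmonic (a b m : R) (t : R) : R :=
  a * cos (m * t) + b * sin (m * t).

(** An antiderivative of [harmonic a b m]; at frequency 0 the harmonic is the constant [a]. *)
Definition harmonic_prim (a b m : R) (t : R) : R :=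
  if m == 0 then a * t else m^-1 * harmonic (- b) a m t.

Lemma is_derive_harmonic (a b m t : R) :
  is_derive t 1 (harmonic a b m) (m * harmonic b (- a) m t).
Proof.
have dm : is_derive t 1 (fun t => m * t) m.
  by apply: is_derive_eq; rewrite scaler1.
have dc := is_derive1_comp (is_derive_cos (m * t)) dm.
have ds := is_derive1_comp (is_derive_sin (m * t)) dm.
have := is_deriveD (is_deriveZ a dc) (is_deriveZ b ds).
move/is_derive_eq; apply.
by rewrite /harmonic /GRing.scale /=; ring.
Qed.

Lemma is_derive_harmonic_prim (a b m t : R) :
  is_derive t 1 (harmonic_prim a b m) (harmonic a b m t).
Proof.
rewrite /harmonic_prim; have [->|m0] := eqVneq m 0.
  apply: is_derive_eq; rewrite /harmonic mul0r cos0 sin0 mulr0 addr0 mulr1.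
  by rewrite scaler1.
have := is_deriveZ m^-1 (is_derive_harmonic (- b) a m t).
move/is_derive_eq; apply.
by rewrite opprK /GRing.scale /= mulKf.
Qed.

Lemma continuous_sum_harmonic n (a b m : 'I_n -> R) :
  continuous (fun t => \sum_(k < n) harmonic (a k) (b k) (m k) t).
Proof.
have -> : (fun t => \sum_(k < n) harmonic (a k) (b k) (m k) t) =
    \sum_(k < n) harmonic (a k) (b k) (m k).
  by apply/funext => t; rewrite fct_sumE.
move=> t; apply/differentiable_continuous/derivable1_diffP.
by have [] := is_derive_sum (fun k => is_derive_harmonic (a k) (b k) (m k) t).
Qed.

Lemma sin_int_pi (m : int) : sin (m%:~R * pi : R) = 0.
Proof.
have nat_pi (k : nat) : sin (k%:R * pi : R) = 0.
  elim: k => [|k IH]; first by rewrite mul0r sin0.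
  by rewrite -[k.+1]addn1 natrD mulrDl mul1r sinD IH sinpi mul0r mulr0 addr0.
case: m => k; first exact: nat_pi.
by rewrite NegzE mulrNz mulNr sinN nat_pi oppr0.
Qed.

Lemma Rintegral_sum_harmonic n (a b : 'I_n -> R) (m : 'I_n -> int) :
  \int[@lebesgue_measure R]_(t in `[- pi, pi])
     \sum_(k < n) harmonic (a k) (b k) (m k)%:~R t =
  2 * pi * \sum_(k < n | m k == 0) a k.
Proof.
pose F : R -> R := \sum_(k < n) harmonic_prim (a k) (b k) (m k)%:~R.
have dF (t : R) :
    is_derive t 1 F (\sum_(k < n) harmonic (a k) (b k) (m k)%:~R t).
  exact: is_derive_sum (fun k => is_derive_harmonic_prim _ _ _ t).
have cF (t : R) : {for t, continuous F}.
  by apply/differentiable_continuous/derivable1_diffP; have [] := dF t.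
rewrite /Rintegral (@continuous_FTC2 _ _ F) //=.
(* At a nonzero frequency the cosine terms cancel by parity and the sine terms vanish at integer
   multiples of [pi]; frequency 0 contributes [2 * pi * a k]. *)
- rewrite /F !fct_sumE -sumrB mulr_sumr [RHS]big_mkcond /=.
  apply: eq_bigr => k _; rewrite /harmonic_prim intr_eq0.
  case: ifP => _; first by ring.
  by rewrite /harmonic !mulrN cosN sinN sin_int_pi; ring.
- by rewrite gtrN // pi_gt0.
- exact/continuous_subspaceT/continuous_sum_harmonic.
- split.
  + by move=> t _; have [] := dF t.
  + by apply: cvg_at_right_filter; exact: cF.
  + by apply: cvg_at_left_filter; exact: cF.
- by move=> t _; rewrite derive1E; have [_ ->] := dF t.
Qed.

Lemma Re_sum n (F : 'I_n -> C) :
  complex.Re (\sum_k F k) = \sum_k complex.Re (F k).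
Proof. by apply: (big_morph (@complex.Re R)) => // [[? ?] [? ?]]. Qed.

Lemma Im_sum n (F : 'I_n -> C) :
  complex.Im (\sum_k F k) = \sum_k complex.Im (F k).
Proof. by apply: (big_morph (@complex.Im R)) => // [[? ?] [? ?]]. Qed.

Lemma Re_mul_expi (c : C) (x : R) :
  complex.Re (c * expi x) = complex.Re c * cos x + (- complex.Im c) * sin x.
Proof. by case: c => a b /=; rewrite mulNr. Qed.

Lemma Im_mul_expi (c : C) (x : R) :
  complex.Im (c * expi x) = complex.Im c * cos x + complex.Re c * sin x.
Proof. by case: c => a b /=; rewrite addrC. Qed.

Lemma trigpoly_Re_continuous (f : R -> C) : trigpoly f ->
  continuous (fun t => complex.Re (f t)).
Proof.
case=> d [c fE]; rewrite (_ : (fun _ => _) = fun t =>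
  \sum_(k < d.*2.+1) harmonic (complex.Re (c (k%:Z - d%:Z)))
    (- complex.Im (c (k%:Z - d%:Z))) (k%:Z - d%:Z)%:~R t).
  exact: continuous_sum_harmonic.
apply/funext => t; rewrite fE Re_sum.
by apply: eq_bigr => k _; rewrite Re_mul_expi.
Qed.

Lemma trigpoly_Im_continuous (f : R -> C) : trigpoly f ->
  continuous (fun t => complex.Im (f t)).
Proof.
case=> d [c fE]; rewrite (_ : (fun _ => _) = fun t =>
  \sum_(k < d.*2.+1) harmonic (complex.Im (c (k%:Z - d%:Z)))
    (complex.Re (c (k%:Z - d%:Z))) (k%:Z - d%:Z)%:~R t).
  exact: continuous_sum_harmonic.
apply/funext => t; rewrite fE Im_sum.
by apply: eq_bigr => k _; rewrite Im_mul_expi.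
Qed.

Lemma sqabsE (f : R -> C) (t : R) :
  sqabs f t = complex.Re (f t) ^+ 2 + complex.Im (f t) ^+ 2.
Proof.
rewrite /sqabs; case: (f t) => a b /=.
by rewrite sqr_sqrtr // addr_ge0 // sqr_ge0.
Qed.

Lemma sqabs_continuous (f : R -> C) : trigpoly f -> continuous (sqabs f).
Proof.
move=> fT; rewrite (_ : sqabs f = fun t =>
  complex.Re (f t) ^+ 2 + complex.Im (f t) ^+ 2); last first.
  by apply/funext => t; exact: sqabsE.
move=> t; apply: cvgD; rewrite expr2; under eq_cvg do rewrite expr2.
  by apply: cvgM; exact: trigpoly_Re_continuous.
by apply: cvgM; exact: trigpoly_Im_continuous.
Qed.

(** The continuous counterpart of [circulant_diag_trig]: integral mean and grid mean both pick out
    [c 0]. *)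
Lemma fourier0_trig d (c : int -> C) (f : R -> R) :
  (forall t : R, cplx f t = \sum_(k < d.*2.+1)
     c (k%:Z - d%:Z) * expi ((k%:Z - d%:Z)%:~R * t)) ->
  fourier0 f = complex.Re (c 0).
Proof.
move=> fE; have pi0 : 2 * pi != 0 :> R by rewrite mulf_neq0 // gt_eqF ?pi_gt0.
rewrite /fourier0 /fourier_coef /cintegral /= mul0r subr0.
have -> : \int[@lebesgue_measure R]_(t in `[- pi, pi])
    complex.Re (cplx f t * expi (- (0%:~R * t))) =
  \int[@lebesgue_measure R]_(t in `[- pi, pi])
    \sum_(k < d.*2.+1) harmonic (complex.Re (c (k%:Z - d%:Z)))
      (- complex.Im (c (k%:Z - d%:Z))) (k%:Z - d%:Z)%:~R t.
  apply: eq_Rintegral => t _; rewrite mul0r oppr0 expi0 mulr1 fE Re_sum.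
  by apply: eq_bigr => k _; rewrite Re_mul_expi.
rewrite Rintegral_sum_harmonic mulrA mulVf // mul1r.
have dd : (d < d.*2.+1)%N by lia.
rewrite (big_pred1 (Ordinal dd)) /= ?subrr // => k.
by rewrite subr_eq0; apply/eqP/eqP => [[kd]|->//]; exact: val_inj.
Qed.

Lemma circulant_diag_part n (f : R -> R) :
  (0 < n)%N -> trigpoly_lt n (cplx f) ->
  diag_part (circulant n (cplx f)) = ((fourier0 f)%:C)%:M.
Proof.
move=> n0 [d dn [c fE]]; rewrite (fourier0_trig _ _ _ fE).
rewrite -diag_const_mx /diag_part; congr diag_mx; apply/rowP => i.
rewrite [LHS]mxE [RHS]mxE.
have ci := circulant_diag_trig n0 _ _ _ i dn fE; rewrite ci.
(* [fourier0] keeps only a real part; nothing is lost, since [c 0] is a mean of real grid values. *)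
have : complex.Im (c 0) = 0.
  rewrite -ci circulant_diag // -rmorph_sum /= -[n%:R](rmorph_nat (real_complex R)).
  by rewrite -fmorphV -rmorphM.
by case: (c 0) => a b /= ->.
Qed.

End TrigonometricPolynomials.

(** * Pointwise bounds from the essential supremum *)

Section SupNorm.
Context {R : realType}.

Lemma supnorm_ge0 (f : R -> R) : 0 <= supnorm f.
Proof. by rewrite /supnorm fine_ge0 // Lnorm_ge0. Qed.

(* supnorm is 0 when the essential supremum is infinite. *)
Lemma le_supnorm (f g : R -> R) (t : R) : 0 <= t < 2 * pi -> supnorm f != 0 ->
  {for t, continuous g} -> (\forall s \near t^'+, g s <= f s) ->
  g t <= supnorm f.
Proof.
move=> /andP[t0 t2]; rewrite /supnorm; set mu := mrestr _ _.
have pi0 : 0 < pi :> R := pi_gt0 R.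
have muT : (0 < mu [set: R])%E.
  rewrite /mu /mrestr setTI lebesgue_measure_itv /= lte_fin.
  by rewrite mulr_gt0 // sube0 lte_fin mulr_gt0.
have := Lnorm_ge0 mu +oo%E (EFin \o f); rewrite unlock /= muT.
have := ess_sup_ge mu (abse \o (EFin \o f)).
case: ess_sup => [y| |] /=; rewrite ?eqxx // => ae y0 _ cg gf.
rewrite leNgt; apply/negP => yg.
have ygs : \forall s \near t^'+, y < g s.
  exact: (cvgr_gt (g t) (cvg_at_right_filter cg)).
have [e /= e0 He] : \forall s \near t^'+, y < f s.
  by near=> s; apply: (@lt_le_trans _ _ (g s)); near: s.
(* If [y < g t], then [f] exceeds [y] on the whole of []t, u[], an interval of positive measure
   inside [[0, 2 * pi]], against the almost-everywhere bound. Staying to the right of [t] handles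
   [t = 0] as well. *)
pose u := Num.min (t + e) (2 * pi).
have tu : t < u by rewrite /u lt_min t2 ltrDl e0.
have [N [mN muN0 subN]] := ae.
have tuN : (`]t, u[%classic : set R) `<=` N `&` `[0, 2 * pi].
  move=> s /=; rewrite !in_itv /= /u lt_min => /and3P[ts se s2].
  split; last by rewrite /= !ltW // (le_lt_trans t0).
  apply: subN => /=; rewrite lee_fin; apply/negP; rewrite -ltNge.
  apply: lt_le_trans (ler_norm _); apply: He => //=.
  by rewrite ltr_norml; apply/andP; split; lra.
have : (lebesgue_measure (`]t, u[%classic : set R) <= 0)%E.
  apply: (@le_trans _ _ (mu N)).
    rewrite /mu /mrestr; apply: le_measure => //; rewrite inE.
      exact: measurable_itv.
    by apply: measurableI => //; exact: measurable_itv.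
  by rewrite le_eqVlt; apply/orP; left; apply/eqP; exact: muN0.
by rewrite lebesgue_measure_itv /= lte_fin tu -EFinB lee_fin subr_le0 leNgt tu.
Unshelve. all: by end_near. Qed.

End SupNorm.

(** * The 2x2 problem at one frequency *)

Section Frequency.
Context {R : realType}.
Local Notation C := R[i].
Local Open Scope complex_scope.

Lemma sqabsC (f : R -> C) (t : R) : (sqabs f t)%:C = f t * (f t)^*%R.
Proof. by rewrite -normCK /sqabs rmorphXn. Qed.

(* a, g, c are the values at one frequency of the symbols of the blocks of
   [[a, conj g], [- g, c]], whose determinant is a c + |g|^2, and a0, c0 are
   the diagonal entries. The second alternative is the singular frequency. *)
Definition smoothing_freq (omega a0 c0 a c gg : R) : Prop :=
  [/\ 0 < a * c + gg, omega * (a * c + gg) < 2 * a0 * c &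
      omega * (a * c + gg) < 2 * c0 * a] \/
  [/\ a = 0, gg = 0, 0 <= c & omega * c < 2 * c0].

Variables (omega a0 c0 a c gg : R) (g u s : C).
Hypotheses (a0_gt0 : 0 < a0) (c0_gt0 : 0 < c0) (ggE : gg%:C = g * g^*%R).
Hypothesis freq : smoothing_freq omega a0 c0 a c gg.

(** Here [u] and [s] are Fourier components of the two halves of a vector [w], and [p], [q] those of
    [X *m w]; [excess] is the share of this frequency in the gap of the smoothing inequality. *)
Let p : C := a%:C * u + g^*%R * s.
Let q : C := - g * u + c%:C * s.
Let excess : C := (u^*%R * p + s^*%R * q + (p^*%R * u + q^*%R * s)) -
  omega%:C * ((a0^-1)%:C * (p^*%R * p) + (c0^-1)%:C * (q^*%R * q)).

Let pC : p^*%R = a%:C * u^*%R + g * s^*%R.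
Proof. by rewrite /p rmorphD !rmorphM /= conjC_realC conjCK. Qed.

Let qC : q^*%R = - g^*%R * u^*%R + c%:C * s^*%R.
Proof. by rewrite /q rmorphD !rmorphM /= rmorphN conjC_realC. Qed.

Let g0 : gg = 0 -> g = 0.
Proof.
move=> gg0; move: ggE; rewrite gg0 -normCK => /esym/eqP.
by rewrite expf_eq0 /= normr_eq0 => /eqP.
Qed.

(** The skew off-diagonal terms cancel in the real part of the energy; multiplying by the
    determinant rewrites what remains in terms of [p] and [q]. *)
Let excessE : (a * c + gg)%:C * excess =
  (2 * c - omega * (a * c + gg) / a0)%:C * `|p| ^+ 2 +
  (2 * a - omega * (a * c + gg) / c0)%:C * `|q| ^+ 2.
Proof.
rewrite !normCK /excess.
have -> : u^*%R * p + s^*%R * q + (p^*%R * u + q^*%R * s) =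
  2 * (a%:C * (u * u^*%R) + c%:C * (s * s^*%R)).
  by rewrite pC qC /p /q; ring.
have : (a%:C * c%:C + g * g^*%R) * (a%:C * (u * u^*%R) + c%:C * (s * s^*%R)) =
  c%:C * (p * p^*%R) + a%:C * (q * q^*%R).
  by rewrite pC qC /p /q; ring.
rewrite -ggE; set D := a%:C * _ + _.
set QF := (X in D * X) => DQF.
have -> : (a * c + gg)%:C = D by rewrite rmorphD rmorphM.
rewrite mulrBr mulrCA DQF.
have -> : (2 * c - omega * (a * c + gg) / a0)%:C =
    2 * c%:C - omega%:C * D * (a0^-1)%:C by rewrite /D; ring.
have -> : (2 * a - omega * (a * c + gg) / c0)%:C =
    2 * a%:C - omega%:C * D * (c0^-1)%:C by rewrite /D; ring.
by ring.
Qed.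

Let coef_gt0 (x y : R) : 0 < y -> omega * (a * c + gg) < 2 * y * x ->
  0 < (2 * x - omega * (a * c + gg) / y)%:C.
Proof.
by move=> y0 xy; rewrite ltcR subr_gt0 ltr_pdivrMr // mulrAC.
Qed.

Lemma smoothing_freq_ge0 : 0 <= excess.
Proof.
case: freq => [[D0 Dc Da]|[a_0 /g0 g_0 c_0 wc]].
  have D0C : 0 < (a * c + gg)%:C :> C by rewrite ltcR.
  rewrite -(pmulr_rge0 _ D0C) excessE addr_ge0 // mulr_ge0 ?exprn_ge0 //.
    by rewrite ltW // coef_gt0.
  by rewrite ltW // coef_gt0.
have pE : p = 0 by rewrite /p a_0 g_0 conjC0 !mul0r addr0.
have qE : q = c%:C * s by rewrite /q g_0 oppr0 mul0r add0r.
have qCE : q^*%R = c%:C * s^*%R by rewrite qC g_0 conjC0 oppr0 mul0r add0r.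
have -> : excess = (c * (2 - omega * c / c0))%:C * `|s| ^+ 2.
  rewrite normCK /excess qCE pE qE conjC0; ring.
rewrite mulr_ge0 ?exprn_ge0 // ler0c mulr_ge0 // subr_ge0.
by rewrite ler_pdivrMr // ltW.
Qed.

(** The equality case, which makes the smoothing inequality strict once the frequencies are
    summed. *)
Lemma smoothing_freq_eq0 : excess = 0 -> p = 0 /\ q = 0.
Proof.
move=> e0; case: freq => [[D0 Dc Da]|[a_0 /g0 g_0 c_0 wc]].
  move: excessE; rewrite e0 mulr0 => /esym/eqP.
  have y0 := coef_gt0 _ _ a0_gt0 Dc; have x0 := coef_gt0 _ _ c0_gt0 Da.
  have np (z : C) : 0 <= `|z| ^+ 2 by rewrite exprn_ge0.
  rewrite paddr_eq0 ?(mulr_ge0 (ltW y0) (np p)) ?(mulr_ge0 (ltW x0) (np q)) //.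
  rewrite !mulf_eq0 (gt_eqF y0) (gt_eqF x0) /= !orbb !normr_eq0.
  by move=> /andP[/eqP-> /eqP->].
have pE : p = 0 by rewrite /p a_0 g_0 conjC0 !mul0r addr0.
have qE : q = c%:C * s by rewrite /q g_0 oppr0 mul0r add0r.
have qCE : q^*%R = c%:C * s^*%R by rewrite qC g_0 conjC0 oppr0 mul0r add0r.
split=> //; rewrite qE; have [-> //|cn0] := eqVneq c 0; first by rewrite mul0r.
have cc : 0 < (c * (2 - omega * c / c0))%:C :> C.
  rewrite ltcR mulr_gt0 //; first by rewrite lt_neqAle eq_sym cn0.
  by rewrite subr_gt0 ltr_pdivrMr.
have : (c * (2 - omega * c / c0))%:C * `|s| ^+ 2 = 0.
  rewrite -[RHS]e0 normCK /excess qCE pE qE conjC0; ring.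
move/eqP; rewrite mulf_eq0 gt_eqF //= expf_eq0 /= normr_eq0 => /eqP ->.
by rewrite mulr0.
Qed.

(** A regular block is invertible, which forces [u = s = 0]; the singular block is real diagonal and
    equals its adjoint. *)
Lemma smoothing_freq_ker : p = 0 -> q = 0 ->
  a%:C * u - g^*%R * s = 0 /\ g * u + c%:C * s = 0.
Proof.
move=> p0 q0; case: freq => [[D0 Dc Da]|[a_0 /g0 g_0 c_0 wc]].
  have D0C : (a * c + gg)%:C != 0 :> C by rewrite gt_eqF // ltcR.
  have uE : (a * c + gg)%:C * u = c%:C * p - g^*%R * q.
    by rewrite rmorphD rmorphM /= ggE /p /q; ring.
  have sE : (a * c + gg)%:C * s = g * p + a%:C * q.
    by rewrite rmorphD rmorphM /= ggE /p /q; ring.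
  move: uE sE; rewrite p0 q0 !mulr0 subr0 addr0 => /eqP + /eqP.
  rewrite !mulf_eq0 (negPf D0C) /= => /eqP -> /eqP ->.
  by rewrite !mulr0 subr0 addr0.
by move: q0; rewrite /q a_0 g_0 conjC0 oppr0 !mul0r add0r subr0 => ->.
Qed.

End Frequency.

(** * Assembling the frequencies by the Fourier transform *)

Section BlockCirculant.
Context {R : realType} {n : nat}.
Local Notation C := R[i].
Local Open Scope complex_scope.
Local Open Scope sesquilinear_scope.
Hypothesis n_gt0 : (0 < n)%N.

Let F : 'M[C]_n := fourier_mx n.

Lemma circulant_mul_col (f : R -> C) (w : 'cV[C]_n) :
  circulant n f *m w = F *m (\col_j (f (grid j) * (F^t* *m w) j 0)).
Proof.
rewrite /circulant -!mulmxA; congr (_ *m _).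
by rewrite mul_diag_mx; apply/colP => j; rewrite [LHS]mxE [RHS]mxE mxE.
Qed.

Lemma fourier_mx_inj (x : 'cV[C]_n) : F *m x = 0 -> x = 0.
Proof.
move=> /(congr1 (mulmx (F^t* ))).
by rewrite mulmxA fourier_mx_adjM // mul1mx mulmx0.
Qed.

Lemma cdot_fourier_mx (x y : 'cV[C]_n) : cdot (F *m x) (F *m y) = cdot x y.
Proof. by rewrite cdot_mull mulmxA fourier_mx_adjM // mul1mx. Qed.

Lemma block_circulant_mul_col (f11 f12 f21 f22 : R -> C) (w1 w2 : 'cV[C]_n) :
  block_mx (circulant n f11) (circulant n f12)
           (circulant n f21) (circulant n f22) *m col_mx w1 w2 =
  col_mx
    (F *m (\col_j (f11 (grid j) * (F^t* *m w1) j 0 +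
                    f12 (grid j) * (F^t* *m w2) j 0)))
    (F *m (\col_j (f21 (grid j) * (F^t* *m w1) j 0 +
                    f22 (grid j) * (F^t* *m w2) j 0))).
Proof.
rewrite mul_block_col !circulant_mul_col -!mulmxDr.
by congr col_mx; apply: (congr1 (mulmx F)); apply/colP => j;
  rewrite [LHS]mxE [RHS]mxE [X in X + _]mxE [X in _ + X]mxE.
Qed.

Variables (fa fc : R -> R) (g : R -> C) (omega a0 c0 : R).
Hypotheses (a0_gt0 : 0 < a0) (c0_gt0 : 0 < c0).
Hypothesis freq : forall j : 'I_n, smoothing_freq omega a0 c0
  (fa (grid j)) (fc (grid j)) (sqabs g (grid j)).

Let X := block_mx (circulant n (cplx fa)) (circulant n (fun t => (g t)^*%R))
                  (circulant n (fun t => - g t)) (circulant n (cplx fc)).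
Let E : 'M[C]_(n + n) := block_mx (a0^-1)%:C%:M 0 0 (c0^-1)%:C%:M.

Let cdotE_col (r1 r2 : 'cV[C]_n) :
  cdot (col_mx r1 r2) (E *m col_mx r1 r2) =
  (a0^-1)%:C * cdot r1 r1 + (c0^-1)%:C * cdot r2 r2.
Proof.
by rewrite mul_block_col !mul0mx add0r addr0 !mul_scalar_mx cdot_col_mx !cdotZr.
Qed.

Lemma block_diag_inv_gt0 (r : 'cV[C]_(n + n)) : r != 0 -> 0 < cdot r (E *m r).
Proof.
rewrite -[r]vsubmxK; set r1 := usubmx r; set r2 := dsubmx r => r0.
have ge0 (x : 'cV[C]_n) : 0 <= cdot x x.
  by rewrite cdotxx sumr_ge0 // => i _; rewrite exprn_ge0.
have a0C : 0 < (a0^-1)%:C :> C by rewrite ltcR invr_gt0.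
have c0C : 0 < (c0^-1)%:C :> C by rewrite ltcR invr_gt0.
rewrite cdotE_col lt_neqAle addr_ge0 ?mulr_ge0 ?(ltW a0C) ?(ltW c0C) // andbT.
rewrite eq_sym paddr_eq0 ?mulr_ge0 ?(ltW a0C) ?(ltW c0C) //.
rewrite !mulf_eq0 !(gt_eqF a0C) !(gt_eqF c0C) /=.
apply: contra r0 => /andP[/eqP/cdotxx_eq0-> /eqP/cdotxx_eq0->].
by rewrite col_mx0.
Qed.

Let p (w1 w2 : 'cV[C]_n) (j : 'I_n) : C :=
  (fa (grid j))%:C * (F^t* *m w1) j 0 + (g (grid j))^*%R * (F^t* *m w2) j 0.
Let q (w1 w2 : 'cV[C]_n) (j : 'I_n) : C :=
  - g (grid j) * (F^t* *m w1) j 0 + (fc (grid j))%:C * (F^t* *m w2) j 0.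

Let X_mul (w1 w2 : 'cV[C]_n) : X *m col_mx w1 w2 =
  col_mx (F *m \col_j p w1 w2 j) (F *m \col_j q w1 w2 j).
Proof. exact: block_circulant_mul_col. Qed.

Lemma block_circulant_ker_adj (w : 'cV[C]_(n + n)) :
  X *m w = 0 -> X^t* *m w = 0.
Proof.
rewrite -[w]vsubmxK; set w1 := usubmx w; set w2 := dsubmx w.
rewrite X_mul => /eqP; rewrite -col_mx0 => /eqP/eq_col_mx[].
move=> /fourier_mx_inj/colP p0 /fourier_mx_inj/colP q0.
have XE : X^t* = block_mx
    (circulant n (cplx fa)) (circulant n (fun t => - (g t)^*%R))
    (circulant n g) (circulant n (cplx fc)).
  have real_adj (f : R -> R) : (circulant n (cplx f))^t* = circulant n (cplx f).
    by rewrite circulant_adj; apply: eq_circulant => j; exact: conjC_realC.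
  have conj_adj : (circulant n (fun t => (g t)^*%R))^t* = circulant n g.
    by rewrite circulant_adj; apply: eq_circulant => j; exact: conjCK.
  have opp_adj : (circulant n (fun t => - g t))^t* =
      circulant n (fun t => - (g t)^*%R).
    by rewrite circulant_adj; apply: eq_circulant => j; exact: rmorphN.
  rewrite /X tr_block_mx map_block_mx.
  by congr block_mx; [exact: real_adj | exact: opp_adj | exact: conj_adj |
    exact: real_adj].
have pq0 j : p w1 w2 j = 0 /\ q w1 w2 j = 0.
  by have := p0 j; have := q0 j; rewrite !mxE.
have K j := smoothing_freq_ker _ _ _ _ _ _ _ _ _ (sqabsC g (grid j)) (freq j)
  (pq0 j).1 (pq0 j).2.
rewrite XE block_circulant_mul_col.
have colj0 (f : 'I_n -> C) : (forall j, f j = 0) -> \col_j f j = 0.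
  by move=> f0; apply/colP => j; rewrite !mxE f0.
by rewrite !colj0 ?mulmx0 ?col_mx0 // => j; rewrite ?mulNr; case: (K j).
Qed.

(** Unitarity of [F] splits the gap into the nonnegative terms [d j]; if their sum vanished, each
    would, and [X *m w] would be zero. *)
Lemma block_circulant_smoothing (w : 'cV[C]_(n + n)) : X *m w != 0 ->
  omega%:C * cdot (X *m w) (E *m (X *m w)) < cdot w (X *m w) + cdot (X *m w) w.
Proof.
rewrite -[w]vsubmxK; set w1 := usubmx w; set w2 := dsubmx w => Xw0.
pose u j := (F^t* *m w1) j 0; pose s j := (F^t* *m w2) j 0.
pose P := p w1 w2; pose Q := q w1 w2.
pose d j : C := ((u j)^*%R * P j + (s j)^*%R * Q j +
    ((P j)^*%R * u j + (Q j)^*%R * s j)) -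
  omega%:C * ((a0^-1)%:C * ((P j)^*%R * P j) + (c0^-1)%:C * ((Q j)^*%R * Q j)).
have dE : cdot (col_mx w1 w2) (X *m col_mx w1 w2) +
    cdot (X *m col_mx w1 w2) (col_mx w1 w2) -
    omega%:C * cdot (X *m col_mx w1 w2) (E *m (X *m col_mx w1 w2)) =
  \sum_(j < n) d j.
  rewrite X_mul cdotE_col !cdot_col_mx !cdot_fourier_mx.
  have cdotFr (v x : 'cV[C]_n) :
      cdot v (F *m x) = \sum_j ((F^t* *m v) j 0)^*%R * x j 0.
    by rewrite cdot_mulr cdotE.
  have cdotFl (v x : 'cV[C]_n) :
      cdot (F *m x) v = \sum_j (x j 0)^*%R * (F^t* *m v) j 0.
    by rewrite cdot_mull cdotE.
  rewrite !cdotFr !cdotFl !cdotE !mulr_sumr -!big_split /= mulr_sumr -sumrB.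
  by apply: eq_bigr => j _; rewrite ![(\col__ _) _ _]mxE.
have d0 j : 0 <= d j.
  exact: smoothing_freq_ge0 _ _ _ _ _ _ _ _ _ a0_gt0 c0_gt0
    (sqabsC g (grid j)) (freq j).
rewrite -subr_gt0 dE lt_neqAle sumr_ge0 // andbT eq_sym.
apply: contra Xw0 => /eqP dd.
have {}dd j : d j = 0 by move/psumr_eq0P: dd => ->.
have PQ j := smoothing_freq_eq0 _ _ _ _ _ _ _ _ _ a0_gt0 c0_gt0
  (sqabsC g (grid j)) (freq j) (dd j).
rewrite X_mul (_ : \col_j p w1 w2 j = 0); last first.
  by apply/colP => j; rewrite !mxE; case: (PQ j).
rewrite (_ : \col_j q w1 w2 j = 0); last first.
  by apply/colP => j; rewrite !mxE; case: (PQ j).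
by rewrite !mulmx0 col_mx0.
Qed.

End BlockCirculant.

(** * Symbols of the transformed saddle-point matrix *)

Lemma block_LAU (S : pzRingType) (n : nat) (A B Bh D K Kh : 'M[S]_n) :
  block_mx 1%:M 0 K (- 1%:M) *m block_mx A Bh B (- D) *m
    block_mx 1%:M (- Kh) 0 1%:M =
  block_mx A (Bh - A *m Kh) (K *m A - B) ((K *m Bh + D) - (K *m A - B) *m Kh).
Proof.
rewrite !mulmx_block !mul1mx !mul0mx !mulmx1 !mulmx0 !addr0 !mulmxN !mulNmx.
by rewrite !mul1mx !opprK ![- _ + _]addrC.
Qed.

Section SaddlePointSymbols.
Context {R : realType} {n : nat}.
Local Notation C := R[i].
Local Open Scope complex_scope.
Local Open Scope sesquilinear_scope.
Variables (alpha : R) (fA fC : R -> R) (fB : R -> C).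
Hypotheses (n_gt0 : (0 < n)%N) (fA_trig : trigpoly_lt n (cplx fA)).

Let A := circulant n (cplx fA).
Let B := circulant n fB.
Let Cm := circulant n (cplx fC).
Let ia := (fourier0 fA)^-1.

(** Symbol of the coupling [G = B (I - alpha A / a0)] that remains because [alpha / a0] only
    approximates the inverse of [A]. *)
Definition offdiag_symbol (t : R) : C :=
  (1 - alpha / fourier0 fA * fA t)%:C * fB t.

Lemma inv_diag_part_circulant : invmx (diag_part A) = (ia%:C)%:M.
Proof. by rewrite circulant_diag_part // invmx_scalar /ia fmorphV. Qed.

Lemma schur_hat_circulant :
  schur_hat alpha A B Cm = circulant n (cplx (schur_symbol alpha fA fB fC)).
Proof.
rewrite /schur_hat inv_diag_part_circulant mul_scalar_mx mul_mx_scalar.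
rewrite -circulant_cst // -!circulantZ -scaleN1r -circulantZ -circulantD.
rewrite circulant_adj !circulantM // -circulantD; apply: eq_circulant => j.
rewrite /cplx /schur_symbol -/ia.
set a := fA _; set c := fC _; set b := sqabs _ _; set z := fB _.
have bE : b%:C = z * z^*%R by exact: sqabsC.
transitivity (c%:C + (z * z^*%R) *
  ((2 * alpha * ia)%:C - (alpha ^+ 2 * ia * a * ia)%:C)).
  ring.
rewrite -bE; ring.
Qed.

Lemma saddle_hat_circulant :
  saddle_hat alpha A B Cm =
  block_mx A (circulant n (fun t => (offdiag_symbol t)^*%R))
           (circulant n (fun t => - offdiag_symbol t))
           (circulant n (cplx (schur_symbol alpha fA fB fC))).
Proof.
pose k : C := alpha%:C * ia%:C.
have kB : alpha%:C *: (B *m (ia%:C)%:M) = circulant n (fun t => k * fB t).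
  by rewrite mul_mx_scalar scalerA circulantZ.
have kBh : alpha%:C *: ((ia%:C)%:M *m B^t* ) =
    circulant n (fun t => k * (fB t)^*%R).
  by rewrite mul_scalar_mx scalerA circulant_adj circulantZ.
rewrite /saddle_hat /saddle_L /saddle_mx /saddle_U inv_diag_part_circulant.
rewrite kB kBh [B^t*]circulant_adj block_LAU.
have symbolE (t : R) : offdiag_symbol t = fB t - k * (cplx fA t * fB t).
  by rewrite /offdiag_symbol /cplx -/ia /k; ring.
have symbolCE (t : R) :
    (offdiag_symbol t)^*%R = (fB t)^*%R - k * (cplx fA t * (fB t)^*%R).
  rewrite /offdiag_symbol rmorphM [X in X * _]conjC_realC /cplx -/ia /k.
  by ring.
have kBA : circulant n (fun t => k * fB t) *m A - B =
    circulant n (fun t => - offdiag_symbol t).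
  rewrite circulantM // -scaleN1r -circulantZ -circulantD.
  by apply: eq_circulant => j; rewrite symbolE; ring.
congr block_mx.
- rewrite circulantM // -scaleN1r -circulantZ -circulantD.
  by apply: eq_circulant => j; rewrite symbolCE; ring.
- exact: kBA.
- rewrite kBA !circulantM // -scaleN1r -circulantZ -!circulantD.
  apply: eq_circulant => j; rewrite /offdiag_symbol /cplx /schur_symbol -/ia /k.
  set a := fA _; set c := fC _; set b := sqabs _ _; set z := fB _.
  have bE : b%:C = z * z^*%R by exact: sqabsC.
  transitivity (c%:C + (z * z^*%R) *
    ((2 * alpha * ia)%:C - (alpha ^+ 2 * ia * a * ia)%:C)); first by ring.
  by rewrite -bE; ring.
Qed.

End SaddlePointSymbols.

(** * How the bounds on the damping parameter control one frequency *)

Section Symbols.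
Context {R : realType}.

(** Covers a regular frequency: [M] stands for the norm of [fA], [N] for that of [fC + |fB|^2 / fA],
    and each of the two upper bounds on [omega] yields one inequality of [smoothing_freq]. *)
Lemma saddle_smoothing_freq (omega alpha a0 c0 a b c M N : R) :
  0 < alpha -> 0 < a0 -> 0 < omega -> 0 < a -> a <= M -> 0 < b -> 0 <= c ->
  0 < N -> c + b / a <= N ->
  omega < 2 * (2 * alpha - alpha ^+ 2 / a0 * M) -> omega * N < 2 * c0 ->
  smoothing_freq omega a0 c0 a
    (c + alpha * b / a0 * (2 - alpha / a0 * a)) ((1 - alpha / a0 * a) ^+ 2 * b).
Proof.
move=> alpha0 a00 w0 a_0 aM b0 c_0 N0 cN wk wN; left.
set k := alpha / a0.
have alphaE : alpha = k * a0 by rewrite /k divfK ?gt_eqF.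
have k0 : 0 < k by rewrite /k divr_gt0.
(* With [x = k * a], the identity [x (2 - x) + (1 - x)^2 = 1] removes [alpha] from the
   determinant. *)
have -> : a * (c + alpha * b / a0 * (2 - k * a)) + (1 - k * a) ^+ 2 * b =
    a * c + b.
  by rewrite [alpha * b / a0](_ : _ = k * b); [ring | rewrite /k mulrAC].
have D0 : 0 < a * c + b by rewrite ltr_wpDl // mulr_ge0 // ltW.
split=> //.
- pose kappa := 2 * alpha - alpha ^+ 2 / a0 * M.
  have kappaE : kappa = alpha * (2 - k * M) by rewrite /kappa /k; ring.
  apply: (@lt_le_trans _ _ (2 * kappa * (a * c + b))).
    by rewrite ltr_pM2r.
  have -> : 2 * a0 * (c + alpha * b / a0 * (2 - k * a)) =
      2 * (a0 * c + alpha * (2 - k * a) * b) by field; rewrite gt_eqF.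
  (* kappa a <= a0 because x (2 - x) <= 1 at x = k a. *)
  rewrite -mulrA ler_pM2l // mulrDr; apply: lerD.
    rewrite mulrA ler_wpM2r // kappaE alphaE.
    have -> : k * a0 * (2 - k * M) * a = a0 * (k * a * (2 - k * M)) by ring.
    rewrite ger_pMr //; apply: (@le_trans _ _ (k * a * (2 - k * a))).
      have ka0 : 0 < k * a by rewrite mulr_gt0.
      by rewrite (ler_pM2l ka0) lerD2l lerN2 (ler_pM2l k0).
    have := sqr_ge0 (1 - k * a); set x := k * a.
    have -> : (1 - x) ^+ 2 = 1 - x * (2 - x) by ring.
    by rewrite subr_ge0.
  (* For the terms in [b], [a <= M] already gives [kappa <= alpha * (2 - k * a)]. *)
  by rewrite kappaE ler_pM2r // ler_pM2l // lerD2l lerN2 ler_pM2l.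
- have -> : a * c + b = a * (c + b / a) by field; rewrite gt_eqF.
  rewrite mulrCA [ltRHS]mulrC ltr_pM2l //; apply: le_lt_trans wN.
  by rewrite ler_pM2l.
Qed.

End Symbols.

(** * The inverse diagonal of a block matrix *)

Section BlockDiagonal.
Context {R : realType}.
Local Open Scope complex_scope.

Lemma diag_part_block_mx (m n : nat) (A : 'M[R[i]]_m) B C (D : 'M[R[i]]_n) :
  diag_part (block_mx A B C D) = block_mx (diag_part A) 0 0 (diag_part D).
Proof.
rewrite /diag_part -diag_mx_row; congr diag_mx; apply/rowP => i.
case: (split_ordP i) => j ->; rewrite ?row_mxEl ?row_mxEr [LHS]mxE [RHS]mxE.
  by rewrite block_mxEul.
by rewrite block_mxEdr.
Qed.

Lemma invmx_block_scalar (m n : nat) (a d : R) : a != 0 -> d != 0 ->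
  invmx (block_mx (a%:C)%:M 0 0 (d%:C)%:M) =
  block_mx (a^-1)%:C%:M 0 0 (d^-1)%:C%:M :> 'M[R[i]]_(m + n).
Proof.
move=> a0 d0; set Y := block_mx (_^-1)%:C%:M _ _ _; set X := block_mx _ _ _ _.
have XY : X *m Y = 1%:M.
  rewrite mulmx_block !mulmx0 !mul0mx !addr0 !add0r -!scalar_mxM -!rmorphM /=.
  by rewrite !mulfV // -scalar_mx_block.
have /andP[uX _] : (X \in unitmx) && (Y \in unitmx) by apply/andP/mulmx1_unit.
by rewrite -[LHS]mulmx1 -XY mulKmx.
Qed.

End BlockDiagonal.

(** * Grid points and the convergence theorem *)

Lemma grid_itv (R : realType) (n : nat) (j : 'I_n) :
  0 <= (grid j : R) < 2 * pi.
Proof.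
have n0 : (0 < n)%N by apply: leq_ltn_trans (ltn_ord j).
have pi0 := pi_gt0 R; apply/andP; split.
  by rewrite !mulr_ge0 ?invr_ge0 ?ler0n // ltW.
by rewrite ltr_pdivrMr ?ltr0n // ltr_pM2l ?mulr_gt0 // ltr_nat.
Qed.

Theorem theorem2 (R : realType) (n : nat) (theta0 : R)
  (fA fC : R -> R) (fB : R -> R[i]) (alpha : R)
  (A := circulant n (cplx fA)) (B := circulant n fB)
  (C := circulant n (cplx fC))
  (fChat := schur_symbol alpha fA fB fC)
  (n_gt0 : (0 < n)%N) (n_even : ~~ odd n)
  (theta0_ge0 : 0 <= theta0) (theta0_lt : theta0 < 2 * pi)
  (fA_trig : trigpoly_lt n (cplx fA))
  (fB_trig : trigpoly_lt n fB)
  (fC_trig : trigpoly_lt n (cplx fC))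
  (fChat_trig : trigpoly_lt n (cplx fChat))
  (fA_theta0 : fA theta0 = 0)
  (fA_gt0 : forall t : R, 0 <= t < 2 * pi -> t <> theta0 -> 0 < fA t)
  (fC_ge0 : forall t : R, 0 <= fC t)
  (fB_theta0 : sqabs fB theta0 = 0)
  (fB_gt0 : forall t : R, 0 <= t < 2 * pi -> t <> theta0 -> 0 < sqabs fB t)
  (fB_fA : (lime_sup (fun t : R => (sqabs fB t / fA t)%:E) theta0 < +oo)%E)
  (alpha_gt0 : 0 < alpha) (alpha_lt : alpha < 2 * fourier0 fA / supnorm fA) :
  schur_hat alpha A B C = circulant n (cplx fChat) /\
  forall (pA pC : R -> R[i]) (omega : R),
    trigpoly pA -> trigpoly pC ->
    (forall t : R, 0 <= t <= 2 * pi -> 0 < sqabs pA t + sqabs pA (t + pi)) ->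
    (forall t : R, 0 <= t <= 2 * pi -> 0 < sqabs pC t + sqabs pC (t + pi)) ->
    (lime_sup (fun t : R => (sqabs pA (t + pi) / fA t)%:E) theta0 < +oo)%E ->
    (lime_sup (fun t : R => (sqabs pC (t + pi) / fChat t)%:E) theta0
       < +oo)%E ->
    0 < omega ->
    omega < 2 * Num.min
      (2 * alpha - alpha ^+ 2 / fourier0 fA * supnorm fA)
      (fourier0 fChat
         * (supnorm (fun t : R => fC t + sqabs fB t / fA t))^-1) ->
    rho_TGM (saddle_hat alpha A B C)
            (block_mx (prolongation n pA) 0 0 (prolongation n pC)) omega < 1.
Proof.
have cA t : {for t, continuous fA}.
  have /trigpoly_Re_continuous : trigpoly (cplx fA).
    by case: fA_trig => d _ ?; exists d.
  exact.
have cC t : {for t, continuous fC}.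
  have /trigpoly_Re_continuous : trigpoly (cplx fC).
    by case: fC_trig => d _ ?; exists d.
  exact.
have cB t : {for t, continuous (sqabs fB)}.
  by apply: sqabs_continuous; case: fB_trig => d _ ?; exists d.
(* A zero norm would make the upper bound on [alpha] equal to 0, as division by 0 gives 0; [N0]
   below excludes the same degeneracy in the bound on [omega]. *)
have M0 : supnorm fA != 0.
  apply/eqP => M0; move: alpha_lt; rewrite M0 invr0 mulr0.
  by move/(lt_trans alpha_gt0); rewrite ltxx.
have a0 : 0 < fourier0 fA.
  have M_gt0 : 0 < supnorm fA by rewrite lt_neqAle eq_sym M0 supnorm_ge0.
  move: (lt_trans alpha_gt0 alpha_lt).
  by rewrite pmulr_lgt0 ?invr_gt0 // pmulr_rgt0.
split; first exact: schur_hat_circulant.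
move=> pA pC omega _ _ _ _ _ _ w0.
set fN := (fun t : R => _); set N := supnorm fN; set c0 := fourier0 fChat.
move=> w_lt.
have {w_lt} [wk wN] :
    omega < 2 * (2 * alpha - alpha ^+ 2 / fourier0 fA * supnorm fA) /\
    omega < 2 * (c0 * N^-1).
  by split; apply: (lt_le_trans w_lt); rewrite ler_pM2l // ge_min lexx ?orbT.
have N0 : N != 0.
  apply/eqP => N0; move: wN; rewrite N0 invr0 !mulr0.
  by move/(lt_trans w0); rewrite ltxx.
have N_gt0 : 0 < N by rewrite lt_neqAle eq_sym N0 supnorm_ge0.
have c0_gt0 : 0 < c0.
  by move: (lt_trans w0 wN); rewrite pmulr_rgt0 // pmulr_lgt0 // invr_gt0.
have {}wN : omega * N < 2 * c0 by move: wN; rewrite mulrA ltr_pdivlMr.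
have freq (j : 'I_n) : smoothing_freq omega (fourier0 fA) c0 (fA (grid j))
    (fChat (grid j)) (sqabs (offdiag_symbol alpha fA fB) (grid j)).
  have t2 := grid_itv R n j; set t := grid j in t2 *.
  have -> : sqabs (offdiag_symbol alpha fA fB) t =
      (1 - alpha / fourier0 fA * fA t) ^+ 2 * sqabs fB t.
    rewrite !sqabsE /offdiag_symbol; case: (fB t) => x y /=; ring.
  rewrite /fChat /schur_symbol.
  have [tE|/eqP tN] := eqVneq t theta0.
    (* The singular frequency. The value of [fN] at [theta0] is an artefact of 0 / 0, so
       [fC theta0 <= N] comes from continuity of [fC] and [fC <= fN] just to the right. *)
    right; rewrite tE fA_theta0 fB_theta0 !mulr0 !mul0r addr0; split=> //.
    apply: le_lt_trans wN; rewrite ler_pM2l //.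
    apply: le_supnorm => //; first by rewrite -tE.
    near=> s; have s2 : theta0 < s < 2 * pi.
      apply/andP; split; first by near: s; exact: nbhs_right_gt.
      by near: s; exact: nbhs_right_lt.
    case/andP: s2 => ts s2; rewrite /fN lerDl divr_ge0 //.
      by rewrite sqr_ge0.
    apply/ltW/fA_gt0; first by rewrite (le_trans theta0_ge0 (ltW ts)).
    by apply/eqP; rewrite gt_eqF.
  have at0 : 0 < fA t by exact: fA_gt0.
  apply: (saddle_smoothing_freq _ _ _ _ _ _ _ (supnorm fA) N) => //.
  - by apply: (le_supnorm _ _ _ t2 M0 (cA t)); near=> s.
  - exact: fB_gt0.
  (* Away from [theta0] the quotient has a positive denominator, so [fN] is continuous and serves as
     its own minorant. *)
  - apply: (@le_supnorm _ fN fN t) => //.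
      apply: cvgD; first exact: cC.
      by apply: cvgM; [exact: cB | apply: cvgV; [rewrite gt_eqF | exact: cA]].
    by near=> s.
have XE := saddle_hat_circulant alpha fA fC fB n_gt0 fA_trig.
have EE : invmx (diag_part (saddle_hat alpha A B C)) =
    block_mx (real_complex R (fourier0 fA)^-1)%:M 0 0 (real_complex R c0^-1)%:M.
  rewrite XE diag_part_block_mx !circulant_diag_part //.
  by rewrite invmx_block_scalar // gt_eqF.
rewrite /rho_TGM; apply: quotient_spectral_radius_lt1.
  (* The iteration fixes the kernel pointwise, so it acts on the quotient. *)
  by move=> v Xv; rewrite TGM_ker.
move=> l; apply: TGM_quotient_eigenvalue_lt1 => //.
- by move=> r r0; rewrite EE block_diag_inv_gt0.
- by move=> w; rewrite EE XE; apply: block_circulant_smoothing.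
- by move=> w; rewrite XE; apply: block_circulant_ker_adj freq _.
Unshelve. all: by end_near. Qed.
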